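(* Fix $\alpha>0$. Let $u_0:(0,1]\to[0,1]$ be a function that is continuous on $(0,1)$, and let $v_{0,-},v_{0,+}\in[0,1]$. For each positive integer $N$ write $\epsilon=1/N$ and consider the channel–reservoir process $(\omega_t)_{t\ge0}$ on $\Omega_N$ with generator $\mathbf L$ (defined in the context), with law $\mathbf P^{\epsilon}$, expectation $\mathbf E^{\epsilon}$, and mean densities $\rho^{\epsilon}(x,t)$, $\rho^{\epsilon}_\pm(t)$. Assume that at the initial time $$\frac{n_{\pm}(0)}{M}\longrightarrow v_{0,\pm}\ \text{ in } \mathbf P^{\epsilon}\text{-probability as } N\to\infty,\qquad \rho^{\epsilon}(x,0)=u_0(\epsilon x)\quad\text{for all }x\in\Lambda_N .$$ Then for any $r\in[0,1]$ and $t>0$, as $N\to\infty$, $\rho^{\epsilon}([Nr],N^{2+\alpha}t)$ converges to $u(r,t)$ and $\rho^{\epsilon}_{\pm}(N^{2+\alpha}t)$ converges to $v_\pm(t)$, respectively, where $$u(r,t)=\big(v_+(t)-v_-(t)\big)r+v_-(t),$$ and $v_\pm$ satisfy $\lim_{t\to0}v_\pm(t)=v_{0,\pm}$ and $$\frac{d}{dt}v_-(t)=\tfrac12\big(v_+(t)-v_-(t)\big),\qquad \frac{d}{dt}v_+(t)=-\tfrac12\big(v_+(t)-v_-(t)\big).$$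
   Context: Channel–reservoir process. For a positive integer $N$ let $\Lambda_N=\{1,\dots,N\}$ and let $M=\lfloor N^{1+\alpha}\rfloor$ be the size of each reservoir. The state space is $\Omega_N=\{0,1\}^{\Lambda_N}\times\{0,\dots,M\}\times\{0,\dots,M\}$, with elements $\omega=(\eta(1),\dots,\eta(N),n_-,n_+)$. The process is the continuous-time Markov chain with generator $$\mathbf Lf(\omega)=\tfrac12\sum_{x=1}^{N-1}[f(\omega^{x,x+1})-f(\omega)]+c_N(\omega)[f(\omega^N)-f(\omega)]+c_1(\omega)[f(\omega^1)-f(\omega)],$$ where $\omega^{x,x+1}$ is obtained from $\omega$ by exchanging $\eta(x)$ and $\eta(x+1)$; $c_N(\omega)=\tfrac12(1-\tfrac{n_+}{M})\eta(N)+\tfrac12\tfrac{n_+}{M}(1-\eta(N))$, and $\omega^N$ is obtained from $\omega$ by replacing $(\eta(N),n_+)$ by $(0,n_++1)$ if $\eta(N)=1$ and by $(1,n_+-1)$ if $\eta(N)=0$; $c_1(\omega)=\tfrac12(1-\tfrac{n_-}{M})\eta(1)+\tfrac12\tfrac{n_-}{M}(1-\eta(1))$, and $\omega^1$ is obtained by replacing $(\eta(1),n_-)$ by $(0,n_-+1)$ if $\eta(1)=1$ and by $(1,n_--1)$ if $\eta(1)=0$. The values at time $t$ are $\eta(x,t)$, $n_\pm(t)$. The initial distribution may depend on $N$. Mean densities. Put $\eta(0,t)=n_-(t)/M$, $\eta(N+1,t)=n_+(t)/M$, and $\rho^{\epsilon}(x,t)=\mathbf E^{\epsilon}[\eta(x,t)]$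 for $x\in\{0,1,\dots,N+1\}$; $\rho^{\epsilon}_-(t)=\rho^{\epsilon}(0,t)$, $\rho^{\epsilon}_+(t)=\rho^{\epsilon}(N+1,t)$. $[\cdot]$ denotes the integer part. *)

(* Defs.v *)
From HB Require Import structures.
From mathcomp Require Import all_boot all_order all_algebra all_fingroup.
From mathcomp Require Import all_classical all_reals all_analysis.

Set Implicit Arguments.
Unset Strict Implicit.
Unset Printing Implicit Defensive.

Import Order.TTheory GRing.Theory Num.Theory.
Import numFieldNormedType.Exports.

Local Open Scope classical_set_scope.
Local Open Scope ring_scope.

(* Continuous-time Markov chains on a finite state space. *)

Record transition_semigroup (R : realType) (S : finType)
    (L : (S -> R) -> S -> R) (p : R -> S -> S -> R) : Prop := {
  ts_ge0 : forall t a b, 0 <= t -> 0 <= p t a b ;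
  ts_sum1 : forall t a, 0 <= t -> \sum_(b : S) p t a b = 1 ;
  ts_0 : forall a b, p 0 a b = (a == b)%:R ;
  ts_add : forall s t a b, 0 <= s -> 0 <= t ->
    p (s + t) a b = \sum_(c : S) p s a c * p t c b ;
  ts_generator : forall (f : S -> R) a,
    h^-1 * (\sum_(b : S) p h a b * f b - f a) @[h --> 0^'+] --> L f a }.

Definition natural_filtration (R : realType) (T S : Type) (X : R -> T -> S)
    (s : R) : set (set T) :=
  <<s [set A | exists u a, 0 <= u <= s /\ A = X u @^-1` [set a]] >>.

(* [markov_property] is P(X_{s+h} = b | F_s) = p_h(X_s, b), tested on the sets
   A `&` {X_s = a}, A in F_s, which determine the conditional probability since
   S is finite.  The initial law is unconstrained. *)
Record markov_chain (R : realType) (d : measure_display)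
    (T : measurableType d) (P : probability T R) (S : finType)
    (L : (S -> R) -> S -> R) (X : R -> T -> S) : Prop := {
  markov_measurable : forall t a, 0 <= t -> measurable (X t @^-1` [set a]) ;
  markov_property : exists2 p : R -> S -> S -> R, transition_semigroup L p &
    forall s h a b A, 0 <= s -> 0 <= h -> natural_filtration X s A ->
      P (A `&` X s @^-1` [set a] `&` X (s + h) @^-1` [set b]) =
      (P (A `&` X s @^-1` [set a]) * (p h a b)%:E)%E }.

(* The channel-reservoir process with N = n.+1 channel sites and reservoirs of
   size M.  The site x in {1, ..., N} is the ordinal x.-1 : 'I_n.+1, so that
   ord0 is site 1 and ord_max is site N; a state is (eta, n_-, n_+). *)

Definition state (n M : nat) : finType :=
  ({ffun 'I_n.+1 -> bool} * 'I_M.+1 * 'I_M.+1)%type.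

Section Channel.
Variables (R : realType) (n M : nat).
Implicit Types (w : state n M) (k : 'I_M.+1).

Definition eta w : {ffun 'I_n.+1 -> bool} := w.1.1.
Definition nminus w : 'I_M.+1 := w.1.2.
Definition nplus w : 'I_M.+1 := w.2.

Definition set_site w (i : 'I_n.+1) (b : bool) : {ffun 'I_n.+1 -> bool} :=
  [ffun j => if j == i then b else eta w j].

Definition swap w (i j : 'I_n.+1) : state n M :=
  ([ffun z => eta w (tperm i j z)], nminus w, nplus w).

(* The out-of-range cases (k = M with b = true, k = 0 with b = false) are
   irrelevant: there [reservoir_rate] vanishes as soon as 0 < M. *)
Definition reservoir_update (b : bool) k : 'I_M.+1 :=
  if b then inord k.+1 else inord k.-1.

Definition reservoir_rate (b : bool) k : R :=
  2^-1 * (1 - k%:R / M%:R) * b%:R + 2^-1 * (k%:R / M%:R) * (1 - b%:R).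

Definition rate_right w : R := reservoir_rate (eta w ord_max) (nplus w).
Definition rate_left w : R := reservoir_rate (eta w ord0) (nminus w).

Definition jump_right w : state n M :=
  (set_site w ord_max (~~ eta w ord_max), nminus w,
   reservoir_update (eta w ord_max) (nplus w)).

Definition jump_left w : state n M :=
  (set_site w ord0 (~~ eta w ord0),
   reservoir_update (eta w ord0) (nminus w), nplus w).

(* The i-th term of the sum is the bond between sites i + 1 and i + 2. *)
Definition generator (f : state n M -> R) w : R :=
  2^-1 * (\sum_(i < n)
            (f (swap w (widen_ord (leqnSn n) i) (lift ord0 i)) - f w))
  + rate_right w * (f (jump_right w) - f w)
  + rate_left w * (f (jump_left w) - f w).

(* eta(x) for x in {0, ..., N + 1}, the reservoir densities being attached to
   the end points. *)
Definition density w (x : nat) : R :=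
  if x == 0%N then (nminus w)%:R / M%:R
  else if (x <= n.+1)%N then (eta w (inord x.-1))%:R
  else (nplus w)%:R / M%:R.

Definition mean_density (d : measure_display) (T : measurableType d)
    (P : probability T R) (X : R -> T -> state n M) (x : nat) (t : R) : \bar R :=
  ('E_P[fun o => density (X t o) x])%E.

End Channel.

Definition reservoir_size (R : realType) (alpha : R) (N : nat) : nat :=
  Num.truncn (N%:R `^ (1 + alpha)).

(* The probability space may depend on n. *)
Definition cvg_in_probability (R : realType) (d : nat -> measure_display)
    (T : forall n, measurableType (d n)) (P : forall n, probability (T n) R)
    (Y : forall n, T n -> R) (l : R) : Prop :=
  forall delta : R, 0 < delta ->
    P n [set o | delta <= `|Y n o - l|] @[n --> \oo] --> 0%E.

(* Main.v *)
Require Import Defs.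
From HB Require Import structures.
From mathcomp Require Import all_boot all_order all_algebra all_fingroup.
From mathcomp Require Import all_classical all_reals all_analysis.
From mathcomp Require Import measurable_realfun ring lra zify.

Import Order.TTheory GRing.Theory Num.Theory.
Import numFieldNormedType.Exports.

Local Open Scope classical_set_scope.
Local Open Scope ring_scope.

(** The mean densities solve a closed linear system. The generator maps each
    density to a linear combination of densities, because the exclusion
    interaction cancels in the exchange terms and the reservoir rates are
    linear in the occupation number; differentiating the semigroup therefore
    gives the heat flow of a reflecting walk on {0, ..., N + 1} in which every
    interior site has mass 1 and the two reservoirs have mass M
    ([mean_density_system]).

    This flow is symmetric for the masses, and pairing it with two functions
    determines the reservoirs. Constants are in its kernel, so
    M (rho_- + rho_+) is conserved up to the interior mass, which is at most N
    ([reservoir_sum_conserved]). The function x - (N + 1) / 2 is harmonic in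
    the interior, so its pairing with rho, which is
    M (N + 1) / 2 (rho_+ - rho_-) up to O(N^2), has derivative exactly
    - (rho_+ - rho_-) / 2. Hence rho_+ - rho_- relaxes at rate
    1 / (M (N + 1)) up to an error O(N / M) ([reservoir_difference_decay]). At
    time N^(2 + alpha) t the exponent converges to t, and N / M to 0.

    In the interior, only smoothing is needed. For a symmetric contraction
    semigroup exp(s A), the norm of A exp(s A) is O(1 / s); since the squared
    norm of rho is at most 2 M + N, the squared discrete Laplacian of rho at
    time s sums to O(M / s^2) ([drift_norm_decay]). The distance from rho to the
    chord joining its reservoir values is at most N + 1 times the l1 norm of
    the discrete Laplacian, so by Cauchy-Schwarz its square is
    O(N^3 M / s^2) = O(N^(- alpha)) at time s = N^(2 + alpha) t
    ([profile_near_linear]). *)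

Set Implicit Arguments.
Unset Strict Implicit.

(** * Differentiating a finite Markov semigroup *)

Lemma cvg_fin_sum (R : realType) (I : finType) (U : Type) (F : set_system U)
    (FF : Filter F) (f : I -> U -> R) (l : I -> R) :
  (forall i, f i x @[x --> F] --> l i) ->
  \sum_i f i x @[x --> F] --> \sum_i l i.
Proof.
move=> fl; apply: cvg_big => //.
exact: add_continuous.
Qed.

(** Pointwise form of [near_eq_cvg], phrased so that the limit of [g] can be
    supplied as a term. *)
Lemma cvg_near_eq (R : realType) (U : Type) (F : set_system U)
    {FF : Filter F} (f g : U -> R) (l : R) :
  (\forall x \near F, f x = g x) -> g x @[x --> F] --> l ->
  f x @[x --> F] --> l.
Proof.
move=> fg gl; apply: cvg_trans gl; apply: near_eq_cvg.
by apply: filterS fg => x ->.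
Qed.

Section Semigroup.
Variables (R : realType) (S : finType) (L : (S -> R) -> S -> R).
Variables (p : R -> S -> S -> R).
Hypothesis hp : transition_semigroup L p.

Definition semigroup_act (t : R) (f : S -> R) (a : S) : R :=
  \sum_b p t a b * f b.

Lemma semigroup_actD s t f a : 0 <= s -> 0 <= t ->
  semigroup_act (s + t) f a = semigroup_act s (semigroup_act t f) a.
Proof.
move=> s0 t0; rewrite /semigroup_act.
under eq_bigr do rewrite (ts_add hp) // mulr_suml.
rewrite exchange_big; apply: eq_bigr => c _.
by rewrite mulr_sumr; apply: eq_bigr => b _; rewrite mulrA.
Qed.

Lemma semigroup_actB t f g a :
  semigroup_act t (fun b => f b - g b) a =
  semigroup_act t f a - semigroup_act t g a.
Proof.
by rewrite /semigroup_act -sumrB; apply: eq_bigr => b _; rewrite mulrBr.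
Qed.

Lemma semigroup_actZ t k f a :
  semigroup_act t (fun b => k * f b) a = k * semigroup_act t f a.
Proof.
by rewrite /semigroup_act mulr_sumr; apply: eq_bigr => b _; rewrite mulrCA.
Qed.

Lemma transition_le1 t a b : 0 <= t -> p t a b <= 1.
Proof.
move=> t0; rewrite -(ts_sum1 hp a t0) (bigD1 b) //= lerDl sumr_ge0 // => c _.
exact: (ts_ge0 hp).
Qed.

Lemma semigroup_act_le t f a : 0 <= t ->
  `|semigroup_act t f a| <= \sum_b `|f b|.
Proof.
move=> t0; rewrite (le_trans (ler_norm_sum _ _ _)) // ler_sum // => b _.
rewrite normrM (ger0_norm (ts_ge0 hp _ _ t0)) -[leRHS]mul1r.
by rewrite ler_wpM2r // transition_le1.
Qed.

Lemma semigroup_act_cvg0 f a : semigroup_act h f a @[h --> 0^'+] --> f a.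
Proof.
apply/subr_cvg0.
have h0 : (h : R) @[h --> (0 : R)^'+] --> (0 : R) by apply: (@cvg_at_right_filter R R id); apply: cvg_id.
have := cvgM h0 (@ts_generator _ _ _ _ hp f a).
rewrite mul0r => H'; apply: (cvg_near_eq _ (H' _)). near=> h.
by rewrite /= mulrA mulfV ?mul1r // gt_eqF.
Unshelve. all: by end_near. Qed.

(** The generator only controls increments to the right of 0. The semigroup
    law moves the increment between [t - h] and [t] to the one between 0 and
    [h], acted on by a contraction. *)
Lemma semigroup_act_cvg_left t f a : 0 < t ->
  semigroup_act (t - h) f a @[h --> 0^'+] --> semigroup_act t f a.
Proof.
move=> t0; apply/subr_cvg0; apply: norm_cvg0.
have C0 : cst 0 h @[h --> (0:R)^'+] --> (0 : R) by exact: cvg_cst.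
have B0 : \sum_b `|f b - semigroup_act h f b| @[h --> 0^'+] --> (0 : R).
  rewrite [X in _ --> X](_ : _ = \sum_(b : S) 0); last by rewrite big1.
  apply: cvg_fin_sum => b.
  have H := @semigroup_act_cvg0 f b.
  have H' : f b - semigroup_act h f b @[h --> 0^'+] --> f b - f b.
    by apply: cvgB H; exact: cvg_cst.
  rewrite subrr in H'; rewrite -[X in _ --> X](normr0 R).
  exact: cvg_norm H'.
apply: squeeze_cvgr C0 B0.
near=> h.
have h0 : 0 < h by [].
have ht : h < t by near: h; apply: nbhs_right_lt.
have -> : semigroup_act t f a = semigroup_act (t - h) (semigroup_act h f) a.
  by rewrite -semigroup_actD ?subrK // ?subr_ge0 ltW.
rewrite normr_ge0 /= -semigroup_actB.
by apply: semigroup_act_le; rewrite subr_ge0 ltW.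
Unshelve. all: by end_near. Qed.

(** Kolmogorov's forward equation. Both one-sided difference quotients are
    averages of the difference quotient at 0: with weights [p t] on the right,
    and [p (t - h)] on the left, which is why left continuity is needed. *)
Lemma is_derive_semigroup_act (t : R) (f : S -> R) (a : S) : 0 < t ->
  is_derive t 1 (fun s => semigroup_act s f a) (semigroup_act t (L f) a).
Proof.
move=> t0.
suff H : h^-1 *: (semigroup_act (h *: 1 + t) f a - semigroup_act t f a)
    @[h --> 0^'] --> semigroup_act t (L f) a.
  by apply: DeriveDef; [apply/cvg_ex; eexists; exact: H | exact: cvg_lim].
apply: (@cvg_at_right_left_dnbhs _ R^o).
  have H : \sum_b p t a b * (h^-1 * (semigroup_act h f b - f b)) @[h --> 0^'+]
     --> semigroup_act t (L f) a.
    apply: cvg_fin_sum => b; apply: cvgM; first exact: cvg_cst.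
    exact: (ts_generator hp).
  apply: (cvg_near_eq _ H). near=> h.
  have h0 : 0 < h by [].
  rewrite [RHS](semigroup_actZ t h^-1 (fun b => semigroup_act h f b - f b)).
  rewrite semigroup_actB -semigroup_actD ?ltW //.
  have -> : h *: 1 + t = t + h by rewrite [_ *: _]mulr1 addrC.
  by [].
have := @cvg_at_leftNP R R^o
  (fun h => h^-1 *: (semigroup_act (h *: 1 + t) f a - semigroup_act t f a)) 0
  (semigroup_act t (L f) a).
rewrite oppr0 => /iffRL; apply.
have H : \sum_b p (t - h) a b * (h^-1 * (semigroup_act h f b - f b)) @[h --> 0^'+]
     --> semigroup_act t (L f) a.
  apply: cvg_fin_sum => b; apply: cvgM; last exact: (ts_generator hp).
  have := @semigroup_act_cvg_left t (fun c => (c == b)%:R) a t0.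
  have E s : semigroup_act s (fun c => (c == b)%:R) a = p s a b.
    rewrite /semigroup_act (bigD1 b) //= eqxx mulr1 big1 ?addr0 // => c /negPf ->.
    by rewrite mulr0.
  by rewrite E; under eq_fun do rewrite E.
apply: (cvg_near_eq _ H). near=> h.
have h0 : 0 < h by [].
have ht : h < t by near: h; apply: nbhs_right_lt.
rewrite [RHS](semigroup_actZ _ h^-1 (fun b => semigroup_act h f b - f b)).
rewrite semigroup_actB -semigroup_actD ?subr_ge0 ?(ltW h0) ?(ltW ht) //.
have -> : - h *: 1 + t = t - h by rewrite [_ *: _]mulr1 addrC.
by rewrite subrK invrN scaleNr -scalerN opprB.
Unshelve. all: by end_near. Qed.

End Semigroup.

(** * The generator acting on densities *)

Section ReflectingLaplacian.
Variables (R : realType) (K : nat) (M : R).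

Definition mass (x : nat) : R := if (x == 0%N) || (x == K) then M else 1.

(** Both boundary conditions come from truncation, [K] being the largest index:
    [minn x.+1 K] is [x] at [x = K], and [x.-1] is [x] at [x = 0], so the
    missing bonds contribute zero differences. *)
Definition reflecting_laplacian (g : nat -> R) (x : nat) : R :=
  2^-1 * (g (minn x.+1 K) - g x - (g x - g x.-1)).

Definition drift (g : nat -> R) (x : nat) : R := (mass x)^-1 * reflecting_laplacian g x.

Lemma reflecting_laplacianE g x : (x <= K)%N ->
  reflecting_laplacian g x =
  2^-1 * ((x < K)%N%:R * (g x.+1 - g x) - (0 < x)%N%:R * (g x - g x.-1)).
Proof.
rewrite /reflecting_laplacian leq_eqVlt => /predU1P[->|xK].
  rewrite (minn_idPr (leqnSn K)) ltnn subrr mul0r.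
  by case: K => [|k] /=; ring.
by rewrite (minn_idPl xK) xK mul1r; case: x {xK} => [|x] /=; ring.
Qed.

(** Each bond contributes with opposite signs at its two ends. *)
Lemma sum_by_parts (f g : nat -> R) :
  \sum_(x < K.+1) f x * reflecting_laplacian g x =
  - (2^-1 * \sum_(x < K) (f x.+1 - f x) * (g x.+1 - g x)).
Proof.
under eq_bigr => x _ do rewrite reflecting_laplacianE ?leq_ord //.
have -> : \sum_(x < K.+1) f x *
      (2^-1 * ((x < K)%N%:R * (g x.+1 - g x) - (0 < x)%N%:R * (g x - g x.-1)))
  = 2^-1 * (\sum_(x < K.+1) ((x < K)%N)%:R * (f x * (g x.+1 - g x)) -
            \sum_(x < K.+1) ((0 < x)%N)%:R * (f x * (g x - g x.-1))).
  rewrite -sumrB mulr_sumr; apply: eq_bigr => x _; ring.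
rewrite big_ord_recr /= ltnn mul0r addr0 big_ord_recl /= mul0r add0r.
rewrite -mulrN -sumrB -sumrN; congr (_ * _); apply: eq_bigr => x _.
rewrite ltn_ord /bump /=; ring.
Qed.

End ReflectingLaplacian.

Section GeneratorOnDensities.
Variables (R : realType) (n M : nat).
Hypothesis M0 : (0 < M)%N.
Implicit Types w : state n M.

Lemma MR_neq0 : M%:R != 0 :> R. Proof. by rewrite pnatr_eq0 -lt0n. Qed.

Lemma density_site w (i : 'I_n.+1) : density R w i.+1 = (Defs.eta w i)%:R.
Proof. by rewrite /density /= ltnS -ltnS ltn_ord inord_val. Qed.

Lemma densityl w : density R w 0 = (nminus w)%:R / M%:R. Proof. by []. Qed.

Lemma densityr w : density R w n.+2 = (nplus w)%:R / M%:R.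
Proof. by rewrite /density /= ltnn. Qed.

(** An exchange is visible only at the two ends of the bond, and the change is
    linear in the occupation numbers. *)
Lemma swap_bond w (i : 'I_n) x :
  density R (swap w (widen_ord (leqnSn n) i) (lift ord0 i)) x - density R w x =
  (x == i.+1)%:R * (density R w i.+2 - density R w i.+1) -
  (x == i.+2)%:R * (density R w i.+2 - density R w i.+1).
Proof.
case: x => [|x]; first by rewrite !densityl subrr !mul0r subrr.
have [xn|nx] := ltnP x n.+1; last first.
  have xi : (x.+1 == i.+1) = false by apply/negbTE; have := ltn_ord i; lia.
  have xi' : (x.+1 == i.+2) = false by apply/negbTE; have := ltn_ord i; lia.
  rewrite xi xi' !mul0r subr0 /density /= ltnS leqNgt -ltnS.
  by rewrite ltnS nx /= subrr.
have -> : x = Ordinal xn by [].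
move: (Ordinal xn) => {xn}x.
set j := widen_ord _ _; set k := lift _ _.
rewrite (_ : i.+2 = k.+1) // (_ : i.+1 = j.+1) // !density_site.
rewrite /Defs.eta /swap /= ffunE !eqSS.
rewrite (_ : (x == i :> nat) = (x == j)) // (_ : (x == bump 0 i :> nat) = (x == k)) //.
rewrite /Defs.eta; case: tpermP => [->|->|/eqP/negPf -> /eqP/negPf ->].
- rewrite eqxx (_ : (j == k) = false) ?mul1r ?mul0r ?subr0 //.
  by apply/negbTE; rewrite -val_eqE /= /bump; lia.
- rewrite eqxx (_ : (k == j) = false) ?mul1r ?mul0r ?sub0r ?opprB //.
  by apply/negbTE; rewrite -val_eqE /= /bump; lia.
- by rewrite !mul0r !subrr.
Qed.

Lemma sum_swap w x :
  \sum_(i < n) (density R (swap w (widen_ord (leqnSn n) i) (lift ord0 i)) x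
                 - density R w x) =
  ((0 < x)%N && (x < n.+1))%N%:R * (density R w x.+1 - density R w x) -
  ((1 < x)%N && (x < n.+2))%N%:R * (density R w x - density R w x.-1).
Proof.
under eq_bigr do rewrite swap_bond.
rewrite sumrB; congr (_ - _).
  have [/andP[x0 xn]|xn] := boolP (_ && _).
    case: x x0 xn => // x _ xn; rewrite mul1r (bigD1 (Ordinal (xn : (x < n)%N))) //=.
    rewrite eqxx mul1r big1 ?addr0 // => i; rewrite -val_eqE /= => ix.
    by rewrite eqSS eq_sym (negPf ix) mul0r.
  rewrite mul0r big1 // => i _; rewrite (_ : (x == _) = false) ?mul0r //.
  by apply/negbTE; have := ltn_ord i; lia.
have [/andP[x0 xn]|xn] := boolP (_ && _).
  case: x x0 xn => [|[|x]] // _ xn; rewrite mul1r (bigD1 (Ordinal (xn : (x < n)%N))) //=.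
  rewrite eqxx mul1r big1 ?addr0 // => i; rewrite -val_eqE /= => ix.
  by rewrite !eqSS eq_sym (negPf ix) mul0r.
rewrite mul0r big1 // => i _; rewrite (_ : (x == _) = false) ?mul0r //.
by apply/negbTE; have := ltn_ord i; lia.
Qed.

(** The quadratic terms in [b] and [k] cancel, which closes the system for the
    means. Here [b] is the occupation of the site next to the reservoir. *)
Lemma reservoir_flux (b : bool) (k : 'I_M.+1) :
  reservoir_rate R b k * ((~~ b)%:R - b%:R) = 2^-1 * (k%:R / M%:R - b%:R).
Proof. by rewrite /reservoir_rate; case: b => /=; field; exact: MR_neq0. Qed.

(** In the two out-of-range cases of [reservoir_update] the rate is zero. *)
Lemma reservoir_gain (b : bool) (k : 'I_M.+1) :
  reservoir_rate R b k *
    ((reservoir_update b k)%:R / M%:R - k%:R / M%:R) =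
  M%:R^-1 * (2^-1 * (b%:R - k%:R / M%:R)).
Proof.
have M0' := MR_neq0.
rewrite /reservoir_rate /reservoir_update; case: b => /=.
  have [kM|kM] := eqVneq (k : nat) M.
    by rewrite kM; field.
  have kM' : (k < M)%N by have := ltn_ord k; lia.
  by rewrite inordK // -natr1; field.
have [k0|k0] := eqVneq (k : nat) 0%N.
  by rewrite k0; field.
rewrite inordK; last by have := ltn_ord k; lia.
rewrite -[in X in _ - X](prednK (n := k)) ?lt0n // -natr1.
rewrite -[in k%:R](prednK (n := k)) ?lt0n // -natr1; field.
exact: M0'.
Qed.

Lemma jump_right_density w x : (x <= n.+2)%N ->
  rate_right R w * (density R (jump_right w) x - density R w x) =
  (x == n.+1)%:R * (2^-1 * (density R w n.+2 - density R w n.+1)) -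
  (x == n.+2)%:R * (M%:R^-1 * (2^-1 * (density R w n.+2 - density R w n.+1))).
Proof.
move=> xn; case: x xn => [|x]; first by rewrite !densityl subrr mulr0 !mul0r subrr.
rewrite !ltnS => xn; rewrite !eqSS.
have e1 : density R w n.+1 = (Defs.eta w ord_max)%:R by rewrite -(density_site w ord_max).
have [->|xn1] := eqVneq x n.+1.
  rewrite !densityr -[n.+1 == n]/(n.+1 == n) (_ : (n.+1 == n) = false); last lia.
  rewrite mul0r sub0r mul1r reservoir_gain e1; ring.
rewrite mul0r subr0; have xn' : (x < n.+1)%N by lia.
have [->|xnn] := eqVneq x n.
  rewrite mul1r densityr e1 -[n.+1]/(ord_max : 'I_n.+1).+1 !density_site /Defs.eta /= ffunE eqxx.
  exact: reservoir_flux.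
have -> : x = Ordinal xn' by [].
rewrite !density_site /Defs.eta /= ffunE -val_eqE /= (negPf xnn) subrr mulr0.
by rewrite mul0r.
Qed.

Lemma jump_left_density w x : (x <= n.+2)%N ->
  rate_left R w * (density R (jump_left w) x - density R w x) =
  (x == 0%N)%:R * (M%:R^-1 * (2^-1 * (density R w 1 - density R w 0))) -
  (x == 1%N)%:R * (2^-1 * (density R w 1 - density R w 0)).
Proof.
move=> xn.
have e1 : density R w 1 = (Defs.eta w ord0)%:R by rewrite -(density_site w ord0).
case: x xn => [_|x].
  by rewrite !densityl reservoir_gain e1 mul0r mul1r subr0.
rewrite ltnS => xn; rewrite mul0r sub0r eqSS.
have [->|x0] := eqVneq x 0%N.
  rewrite mul1r densityl e1 -[1%N]/(ord0 : 'I_n.+1).+1 !density_site /Defs.eta /= ffunE eqxx.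
  by rewrite [LHS]reservoir_flux -mulrN opprB.
rewrite mul0r oppr0; have [xn1|xn1] := ltnP x n.+1.
  have -> : x = Ordinal xn1 by [].
  rewrite !density_site /Defs.eta /= ffunE -val_eqE /= (negPf x0) subrr mulr0.
  by [].
have -> : x = n.+1 by lia.
by rewrite !densityr subrr mulr0.
Qed.

Lemma generator_density w x : (x <= n.+2)%N ->
  generator (fun w' => density R w' x) w = drift n.+2 M%:R (density R w) x.
Proof.
move=> xn; rewrite /generator sum_swap jump_right_density // jump_left_density //.
rewrite /drift reflecting_laplacianE // /mass; move: (density R w) => g.
have [->|x0] := eqVneq x 0%N; first by rewrite /=; ring.
have [->|x1] := eqVneq x n.+2.
  have -> : (n.+2 < n.+1)%N = false by lia.
  have -> : (n.+2 == n.+1) = false by lia.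
  have -> : (n.+2 == 1%N) = false by lia.
  by rewrite !ltnn !andbF orbT /=; ring.
have -> : (0 < x)%N by lia.
have -> : (x < n.+2)%N by lia.
have [->|xn1] := eqVneq x n.+1.
  rewrite ltnn /=; case: (eqVneq n 0%N) => [->|n0]; rewrite ?eqSS /=.
    rewrite invr1; ring.
  rewrite (negPf n0) (_ : (1 < n.+1)%N); last lia.
  rewrite /= invr1; ring.
have -> : (x < n.+1)%N by lia.
have [->|x1'] := eqVneq x 1%N; first by rewrite /= invr1; ring.
have -> : (1 < x)%N by lia.
rewrite /= invr1; ring.
Qed.

End GeneratorOnDensities.

(** * Derivatives of scalar functions *)

Section DerivativeTools.
Variable R : realType.

Lemma is_derive_fin_sum (I : finType) (h : I -> R -> R) (dh : I -> R) (t : R) :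
  (forall i, is_derive t 1 (h i) (dh i)) ->
  is_derive t 1 (fun s => \sum_i h i s) (\sum_i dh i).
Proof.
move=> H; rewrite (_ : (fun s => _) = \sum_i h i); last first.
  by apply/funext => s; rewrite fct_sumE.
elim/big_ind2 : _ => // [|f df g dg] *; first exact: is_derive_cst.
exact: is_deriveD.
Qed.

Lemma is_derive_mul (f g : R -> R) (df dg t : R) :
  is_derive t 1 f df -> is_derive t 1 g dg ->
  is_derive t 1 (fun s => f s * g s) (df * g t + f t * dg).
Proof.
move=> Hf Hg; rewrite -[fun s => _]/(f * g).
by apply: is_derive_eq; rewrite addrC [X in X + _]mulrC [X in _ + X]mulrC [X in X + _]mulrC.
Qed.

Lemma is_derive_sub (f g : R -> R) (df dg t : R) :
  is_derive t 1 f df -> is_derive t 1 g dg ->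
  is_derive t 1 (fun s => f s - g s) (df - dg).
Proof. by move=> Hf Hg; rewrite -[fun s => _]/(f - g); apply: is_deriveB. Qed.

Lemma is_derive_add (f g : R -> R) (df dg t : R) :
  is_derive t 1 f df -> is_derive t 1 g dg ->
  is_derive t 1 (fun s => f s + g s) (df + dg).
Proof. by move=> Hf Hg; rewrite -[fun s => _]/(f + g); apply: is_deriveD. Qed.

Lemma is_derive_scale (k : R) (f : R -> R) (df t : R) :
  is_derive t 1 f df -> is_derive t 1 (fun s => k * f s) (k * df).
Proof. by move=> Hf; rewrite -[fun s => _]/(k *: f); apply: is_deriveZ. Qed.

Lemma derive_le0_nonincreasing (f df : R -> R) (a b : R) :
  a <= b ->
  (forall s : R, a <= s -> is_derive s 1 f (df s)) ->
  (forall s : R, a <= s -> df s <= 0) -> f b <= f a.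
Proof.
move=> ab Hf Hdf.
have Hin (c : R) : c \in `[a, b] -> is_derive c 1 f (df c).
  by move=> /itvP cab; apply: Hf; rewrite cab.
have Hoo (c : R) : c \in `]a, b[ -> is_derive c 1 f (df c).
  by move=> cab; apply: Hin; exact: subset_itv_oo_cc cab.
have Hc : {within `[a, b], continuous f}.
  by apply: derivable_within_continuous => c /Hin [].
have [c /itvP cab E] := MVT_segment ab Hoo Hc.
by rewrite -subr_le0 E mulr_le0_ge0 ?subr_ge0 // Hdf // cab.
Qed.

(** Variant in which the initial value is a right limit at 0, since the mean
    densities are differentiable at positive times only. *)
Lemma derive_le0_nonincreasing0 (f df : R -> R) (l b : R) :
  0 < b -> (forall s : R, 0 < s -> is_derive s 1 f (df s)) ->
  (forall s : R, 0 < s -> df s <= 0) -> f s @[s --> 0^'+] --> l -> f b <= l.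
Proof.
move=> b0 Hf Hdf fl.
apply: (cvgr_to_ge fl); near=> s.
have s0 : 0 < s by [].
apply: (@derive_le0_nonincreasing f df).
- by near: s; apply: nbhs_right_le.
- by move=> u su; apply: Hf; apply: lt_le_trans su.
- by move=> u su; apply: Hdf; apply: lt_le_trans su.
Unshelve. all: by end_near. Qed.

End DerivativeTools.

(** * The mass-weighted inner product and its Dirichlet form *)

Section WeightedForms.
Variables (R : realType) (K : nat) (M : R).
Local Notation drift := (@drift R K M).
Local Notation mass := (@mass R K M).

Definition inner (f g : nat -> R) : R :=
  \sum_(x < K.+1) mass x * (f x * g x).

Definition energy (f g : nat -> R) : R :=
  2^-1 * \sum_(x < K) (f x.+1 - f x) * (g x.+1 - g x).

Lemma mass0 : mass 0 = M. Proof. by []. Qed.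

Lemma massK : mass K = M. Proof. by rewrite /mass eqxx orbT. Qed.

Lemma mass_interior x : (0 < x < K)%N -> mass x = 1.
Proof. by move=> xK; rewrite /mass ifF //; apply/negbTE; lia. Qed.

Lemma energyC f g : energy f g = energy g f.
Proof. by congr (_ * _); apply: eq_bigr => x _; rewrite mulrC. Qed.

Lemma energy_ge0 f : 0 <= energy f f.
Proof. by rewrite mulr_ge0 ?invr_ge0 // sumr_ge0 // => x _; rewrite -expr2 sqr_ge0. Qed.

Section Derivatives.
Variables (f g : nat -> R -> R) (df dg : nat -> R) (t : R).
Hypothesis Hf : forall x, (x <= K)%N -> is_derive t 1 (f x) (df x).
Hypothesis Hg : forall x, (x <= K)%N -> is_derive t 1 (g x) (dg x).

Lemma is_derive_inner :
  is_derive t 1 (fun s => inner (f^~ s) (g^~ s))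
    (inner df (g^~ t) + inner (f^~ t) dg).
Proof.
rewrite /inner -big_split; apply: is_derive_fin_sum => x.
rewrite /= -mulrDr; apply: is_derive_scale.
by apply: is_derive_mul; [apply: Hf|apply: Hg]; rewrite -ltnS.
Qed.

Lemma is_derive_energy :
  is_derive t 1 (fun s => energy (f^~ s) (g^~ s))
    (energy df (g^~ t) + energy (f^~ t) dg).
Proof.
rewrite /energy -mulrDr -big_split; apply: is_derive_scale.
apply: is_derive_fin_sum => x.
by apply: is_derive_mul; apply: is_derive_sub; (apply: Hf || apply: Hg); have := ltn_ord x; lia.
Qed.

Lemma is_derive_drift x : (x <= K)%N ->
  is_derive t 1 (fun s => drift (f^~ s) x) (drift df x).
Proof.
move=> xK; rewrite /drift /reflecting_laplacian.
do 2 apply: is_derive_scale.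
by do 2?apply: is_derive_sub; apply: Hf; lia.
Qed.

End Derivatives.

Hypothesis M0 : 0 < M.

Lemma mass_gt0 x : 0 < mass x. Proof. by rewrite /mass; case: ifP. Qed.

(** The masses in [inner] cancel those in [drift]. *)
Lemma inner_drift f g : inner f (drift g) = - energy f g.
Proof.
rewrite /energy -sum_by_parts; apply: eq_bigr => x _.
by rewrite mulrCA /drift mulVKf // gt_eqF // mass_gt0.
Qed.

Lemma inner_ge0 f : 0 <= inner f f.
Proof.
apply: sumr_ge0 => x _; apply: mulr_ge0; first exact/ltW/mass_gt0.
by rewrite -expr2 sqr_ge0.
Qed.

End WeightedForms.

Lemma sum_mass (R : realType) (K : nat) (M : R) :
  (0 < K)%N -> \sum_(x < K.+1) mass K M x = 2 * M + K.-1%:R.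
Proof.
case: K => // k _.
rewrite big_ord_recr big_ord_recl /= mass0 massK.
rewrite (eq_bigr (fun=> 1)) => [|i _]; first by rewrite sumr_const card_ord; ring.
by apply: mass_interior; have := ltn_ord i; rewrite /bump; lia.
Qed.

(** * Distance to the chord in terms of second differences *)

Section Interpolation.
Variable R : realType.

(** Cauchy-Schwarz against the constant 1, from the nonnegativity of the sum
    of the squares of [m * a i - \sum_j a j]. *)
Lemma sqr_sum_le (m : nat) (a : 'I_m -> R) :
  (\sum_i a i) ^+ 2 <= m%:R * \sum_i a i ^+ 2.
Proof.
case: m a => [|m] a; first by rewrite big_ord0 expr0n mul0r.
set B := \sum_i a i; set Q := \sum_i a i ^+ 2.
have : 0 <= \sum_i (m.+1%:R * a i - B) ^+ 2 by apply: sumr_ge0 => i _; exact: sqr_ge0.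
have -> : \sum_i (m.+1%:R * a i - B) ^+ 2 = m.+1%:R * (m.+1%:R * Q - B ^+ 2).
  transitivity (\sum_i (m.+1%:R ^+ 2 * a i ^+ 2 - 2 * m.+1%:R * B * a i + B ^+ 2)).
    by apply: eq_bigr => i _; ring.
  rewrite big_split sumrB -!mulr_sumr sumr_const card_ord -/B -/Q.
    rewrite /= -[B *+ _]mulr_natl; ring.
by rewrite pmulr_rge0 // subr_ge0.
Qed.

Lemma increment_oscillation (m : nat) (u : nat -> R) (y z : nat) :
  (y <= m)%N -> (z <= m)%N -> `|u y - u z| <= \sum_(i < m) `|u i.+1 - u i|.
Proof.
wlog zy : y z / (z <= y)%N => [H|] ym zm.
  by case/orP: (leq_total z y) => ?; [|rewrite distrC]; apply: H.
rewrite -(telescope_sumr _ zy) (le_trans (ler_norm_sum _ _ _)) //.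
rewrite -(big_mkord xpredT (fun i => `|u i.+1 - u i|)).
rewrite (big_cat_nat (leq0n z) zm) (big_cat_nat zy ym) /= addrCA lerDl addr_ge0 //.
  by apply: sumr_ge0.
by apply: sumr_ge0.
Qed.

(** After multiplication by [m.+1], the error is a double sum of differences
    between two slopes of [g], and such differences are bounded by the total
    variation of the slope. *)
Lemma interpolation_error (m : nat) (g : nat -> R) (x : nat) : (x <= m.+1)%N ->
  `|g x - (g 0%N + x%:R / m.+1%:R * (g m.+1 - g 0%N))| <=
  m.+1%:R * \sum_(i < m) `|(g i.+2 - g i.+1) - (g i.+1 - g i)|.
Proof.
move=> xm; set B := \sum_(i < m) _.
have K0 : m.+1%:R != 0 :> R by rewrite pnatr_eq0.
have E : m.+1%:R * (g x - (g 0%N + x%:R / m.+1%:R * (g m.+1 - g 0%N))) =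
   \sum_(z < m.+1) \sum_(y < x) ((g y.+1 - g y) - (g z.+1 - g z)).
  have tel k : \sum_(y < k) (g y.+1 - g y) = g k - g 0%N.
    by rewrite -(big_mkord xpredT (fun y => g y.+1 - g y)) telescope_sumr.
  under eq_bigr do rewrite sumrB tel sumr_const card_ord.
  rewrite sumrB sumr_const card_ord sumrMnl tel -(mulr_natl (g x - _)) -(mulr_natl (g m.+1 - _)); field.
  by move: K0; rewrite -natr1 addrC.
rewrite -(ler_pM2l (_ : 0 < m.+1%:R)) // -{1}(ger0_norm (_ : 0 <= m.+1%:R :> R)) // -normrM E.
have B0 : 0 <= B by apply: sumr_ge0.
apply: (le_trans (ler_norm_sum _ _ _)).
apply: (@le_trans _ _ (\sum_(z < m.+1) m.+1%:R * B)); last first.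
  by rewrite sumr_const card_ord -(mulr_natl (_ * B)).
apply: ler_sum => z _; apply: (le_trans (ler_norm_sum _ _ _)).
apply: (@le_trans _ _ (\sum_(y < x) B)).
  apply: ler_sum => y _.
  apply: (@increment_oscillation m (fun i => g i.+1 - g i)); rewrite -ltnS //.
  exact: leq_trans xm.
by rewrite sumr_const card_ord -(mulr_natl B) ler_wpM2r // ler_nat.
Qed.

End Interpolation.

(** * Relaxation of a scalar equation with a bounded perturbation *)

Section Relaxation.
Variable R : realType.

Lemma derive0_constant (f : R -> R) (l b : R) :
  0 < b -> (forall s : R, 0 < s -> is_derive s 1 f 0) ->
  f s @[s --> 0^'+] --> l -> f b = l.
Proof.
move=> b0 Hf fl; apply/eqP; rewrite eq_le; apply/andP; split.
  exact: (@derive_le0_nonincreasing0 R f (fun=> 0)).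
rewrite -lerN2; apply: (@derive_le0_nonincreasing0 R (fun s => - f s) (fun=> 0)) => //.
  by move=> s s0; rewrite -[fun s => _]/(- f) -oppr0; apply: is_deriveN; exact: Hf.
exact: cvgN.
Qed.

(** The function [expR (k * s) * (G s - c)] is nonincreasing. *)
Lemma relaxation_upper (G j : R -> R) (k c l T : R) :
  0 <= k -> 0 <= c -> 0 < T ->
  (forall s : R, 0 < s -> is_derive s 1 G (- (k * (G s - j s)))) ->
  (forall s : R, 0 < s -> j s <= c) -> G s @[s --> 0^'+] --> l ->
  G T <= expR (- (k * T)) * l + c.
Proof.
move=> k0 c0 T0 HG Hj Gl.
have He (s : R) : is_derive s 1 (fun s => expR (k * s)) (k * expR (k * s)).
  have Hk : is_derive s 1 (fun s => k * s) (k * 1) by apply: is_derive_scale.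
  have := @is_derive1_comp R expR (fun s => k * s) s _ _ (is_derive_expR _) Hk.
  by rewrite mulr1 [X in is_derive _ _ _ X]mulrC.
have HH (s : R) : 0 < s -> is_derive s 1 (fun s => expR (k * s) * (G s - c))
    (k * expR (k * s) * (G s - c) + expR (k * s) * (- (k * (G s - j s)) - 0)).
  move=> s0; apply: is_derive_mul; apply: is_derive_sub; exact: HG.
have Hle (s : R) : 0 < s ->
    k * expR (k * s) * (G s - c) + expR (k * s) * (- (k * (G s - j s)) - 0) <= 0.
  move=> s0; rewrite (_ : _ + _ = (k * expR (k * s)) * (j s - c)); last by ring.
  by rewrite mulr_ge0_le0 ?mulr_ge0 ?expR_ge0 // subr_le0 Hj.
have e0 : expR (k * s) @[s --> 0^'+] --> (1 : R).
  rewrite -[X in _ --> X]expR0 -[X in _ --> expR X](mulr0 k).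
  apply: continuous_cvg; first exact: continuous_expR.
  apply: cvgM; first exact: cvg_cst.
  by apply: (@cvg_at_right_filter R R id); apply: cvg_id.
have H0 : expR (k * s) * (G s - c) @[s --> 0^'+] --> 1 * (l - c).
  by apply: cvgM => //; apply: cvgB => //; exact: cvg_cst.
have := derive_le0_nonincreasing0 T0 HH Hle H0.
rewrite mul1r => HT.
have E : expR (- (k * T)) * (expR (k * T) * (G T - c)) = G T - c.
  by rewrite mulrA -expRD addNr expR0 mul1r.
have := ler_wpM2l (expR_ge0 (- (k * T))) HT.
rewrite E mulrBr lerBlDr => /le_trans; apply.
by rewrite -addrA lerD2l addrC lerBlDr lerDl mulr_ge0 ?expR_ge0.
Qed.

Lemma relaxation_estimate (G j : R -> R) (k c l T : R) :
  0 <= k -> 0 <= c -> 0 < T ->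
  (forall s : R, 0 < s -> is_derive s 1 G (- (k * (G s - j s)))) ->
  (forall s : R, 0 < s -> `|j s| <= c) -> G s @[s --> 0^'+] --> l ->
  `|G T - expR (- (k * T)) * l| <= c.
Proof.
move=> k0 c0 T0 HG Hj Gl; rewrite ler_norml; apply/andP; split; last first.
  rewrite lerBlDl; apply: (relaxation_upper k0 c0 T0 HG _ Gl) => s s0.
  by have := Hj s s0; rewrite ler_norml => /andP[].
suff : - G T <= expR (- (k * T)) * - l + c by rewrite mulrN => ?; lra.
apply: (@relaxation_upper (fun s => - G s) (fun s => - j s)) => //.
- move=> s s0; have := is_deriveN (HG s s0).
  by rewrite -[fun s => _]/(- G) (_ : - (k * (- G s - - j s)) = - - (k * (G s - j s))); [apply|ring].
- by move=> s s0; have := Hj s s0; rewrite ler_norml => /andP[]; lra.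
- exact: cvgN.
Qed.

End Relaxation.

(** * Estimates for the heat flow between two reservoirs *)

Section DensityProfile.
Variables (R : realType) (N : nat) (M : R) (rho : nat -> R -> R).
Local Notation K := N.+1.
Hypothesis M0 : 0 < M.
Hypothesis rho_derive : forall (x : nat) (t : R), (x <= K)%N -> 0 < t ->
  is_derive t 1 (rho x) (drift K M (rho^~ t) x).
Hypothesis rho_cvg0 : forall x, (x <= K)%N -> rho x s @[s --> 0^'+] --> rho x 0.
Hypothesis rho01 : forall (x : nat) (t : R), (x <= K)%N -> 0 <= t -> 0 <= rho x t <= 1.

Lemma innerE (f g : nat -> R) :
  inner K M f g = M * (f 0%N * g 0%N + f K * g K) + \sum_(i < N) f i.+1 * g i.+1.
Proof.
rewrite /inner big_ord_recr big_ord_recl /= mass0 massK.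
rewrite (eq_bigr (fun i : 'I_N => f i.+1 * g i.+1)) => [|i _]; first by ring.
by rewrite mass_interior ?mul1r // ltnS; have := ltn_ord i; rewrite /bump; lia.
Qed.

Lemma inner_rho_cvg0 (f : nat -> R) :
  inner K M f (rho^~ s) @[s --> 0^'+] --> inner K M f (rho^~ 0).
Proof.
apply: cvg_fin_sum => x; apply: cvgM; first exact: cvg_cst.
apply: cvgM; first exact: cvg_cst.
by apply: rho_cvg0; rewrite -ltnS.
Qed.

Lemma is_derive_inner_rho (f : nat -> R) (t : R) : 0 < t ->
  is_derive t 1 (fun s => inner K M f (rho^~ s)) (- energy K f (rho^~ t)).
Proof.
move=> t0.
have H := @is_derive_inner R K M (fun x _ => f x) rho (fun=> 0) (drift K M (rho^~ t)) t
  (fun x _ => is_derive_cst (f x) t 1) (fun x xK => rho_derive xK t0).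
apply: (is_derive_eq H).
rewrite inner_drift // [X in X + _]big1 ?add0r // => x _.
by rewrite mul0r mulr0.
Qed.

(** With Q0, Q1, Q2 the squared norm of [rho], its Dirichlet energy, and the
    squared norm of its drift, one has Q0' = - 2 Q1, Q1' = - 2 Q2 and Q2' <= 0. Hence
    Q0 + 2 (s - s0) Q1 + 2 (s - s0)^2 Q2 is nonincreasing on [s0, T], and its
    last term at [T] is bounded by Q0 at s0. Starting at the positive time
    s0 = T / 2 avoids derivatives at 0. *)
Lemma drift_norm_decay (T : R) : 0 < T ->
  inner K M (drift K M (rho^~ T)) (drift K M (rho^~ T)) <=
  2 * (2 * M + N%:R) / T ^+ 2.
Proof.
move=> T0; set s0 := T / 2; have s00 : 0 < s0 by rewrite divr_gt0.
pose r s := rho^~ s; pose a s := drift K M (r s); pose b s := drift K M (a s).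
pose Phi s := inner K M (r s) (r s) + (s - s0) * (2 * energy K (r s) (r s)) +
   (s - s0) * (s - s0) * (2 * inner K M (a s) (a s)).
pose dPhi s := - (4 * (s - s0) ^+ 2 * energy K (a s) (a s)).
have HPhi (s : R) : s0 <= s -> is_derive s 1 Phi (dPhi s).
  move=> ss; have s_gt0 : 0 < s by apply: lt_le_trans ss.
  have Hr x : (x <= K)%N -> is_derive s 1 (rho x) (a s x) by move=> xK; exact: rho_derive.
  have Ha x : (x <= K)%N -> is_derive s 1 (fun u => a u x) (b s x).
    by move=> xK; exact: (@is_derive_drift R K M rho _ s Hr x xK).
  have Hs : is_derive s 1 (fun u => u - s0) (1 - 0) by apply: is_derive_sub.
  have H0 := @is_derive_inner R K M rho rho _ _ s Hr Hr.
  have H1 := is_derive_mul Hs (is_derive_scale 2 (@is_derive_energy R K rho rho _ _ s Hr Hr)).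
  have H2 := is_derive_mul (is_derive_mul Hs Hs)
    (is_derive_scale 2 (@is_derive_inner R K M (fun x u => a u x) (fun x u => a u x) _ _ s Ha Ha)).
  apply: (is_derive_eq (is_derive_add (is_derive_add H0 H1) H2)).
  have inC f g : inner K M f g = inner K M g f.
    by apply: eq_bigr => x _; rewrite [f x * _]mulrC.
  rewrite -/(r s) -/(a s) (inC (a s) (r s)) (inC (b s) (a s)).
  rewrite /b /a !inner_drift // -/(a s).
  rewrite (energyC K (r s) (a s)) /dPhi; ring.
have s0T : s0 <= T by rewrite /s0; lra.
have := derive_le0_nonincreasing s0T HPhi.
have Hle (s : R) : s0 <= s -> dPhi s <= 0.
  move=> _; rewrite oppr_le0 mulr_ge0 ?energy_ge0 //.
  by rewrite mulr_ge0 // sqr_ge0.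
move=> /(_ Hle); rewrite {2}/Phi !subrr !mul0r !addr0 => HT.
have H1 : 0 <= (T - s0) * (2 * energy K (r T) (r T)).
  by rewrite mulr_ge0 ?subr_ge0 // mulr_ge0 // energy_ge0.
have H0 : 0 <= inner K M (r T) (r T) by apply: inner_ge0.
have H2 : inner K M (r s0) (r s0) <= 2 * M + N%:R.
  have <- : \sum_(x < K.+1) mass K M x = 2 * M + N%:R by rewrite sum_mass.
  apply: ler_sum => x _.
  rewrite -[leRHS]mulr1; apply: ler_wpM2l; first exact/ltW/mass_gt0.
  have xK : (x <= K)%N by rewrite -ltnS.
  have /andP[r0 r1] := rho01 xK (ltW s00).
  exact: mulr_ile1.
rewrite ler_pdivlMr ?exprn_gt0 // -/(a T).
move: HT; rewrite /Phi -/(a T) => HT.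
have E : T - s0 = T / 2 by rewrite /s0; field.
rewrite E in HT H1.
have -> : inner K M (a T) (a T) * T ^+ 2 = 2 * (T / 2 * (T / 2) * (2 * inner K M (a T) (a T))) by field.
lra.
Qed.

(** The drift at an interior site is half the second difference, so
    [interpolation_error] and [sqr_sum_le] bound the squared error by
    4 K^2 N times the squared norm estimated in [drift_norm_decay]. *)
Lemma profile_near_linear (x : nat) (T : R) : (x <= K)%N -> 0 < T ->
  (rho x T - (rho 0%N T + x%:R / K%:R * (rho K T - rho 0%N T))) ^+ 2 <=
  8 * K%:R ^+ 2 * N%:R * (2 * M + N%:R) / T ^+ 2.
Proof.
move=> xK T0; pose g y := rho y T; pose a := drift K M g.
have H := @interpolation_error R N g x xK.
set B := \sum_(i < N) _ in H.
have B0 : 0 <= B by apply: sumr_ge0.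
have HB : B ^+ 2 <= 4 * N%:R * inner K M a a.
  apply: (le_trans (sqr_sum_le _)).
  rewrite -mulrA mulrCA ler_wpM2l // innerE mulrDr.
  apply: (@le_trans _ _ (4 * \sum_(i < N) a i.+1 * a i.+1)).
    rewrite mulr_sumr; apply: ler_sum => i _; rewrite real_normK ?num_real //.
    have -> : a i.+1 = 2^-1 * ((g i.+2 - g i.+1) - (g i.+1 - g i)).
      rewrite /a /drift mass_interior ?ltnS ?ltn_ord // /reflecting_laplacian.
      rewrite invr1 mul1r (_ : minn i.+2 K = i.+2) //.
      by apply/minn_idPl; have := ltn_ord i; lia.
    by rewrite le_eqVlt; apply/orP; left; apply/eqP; field.
  rewrite lerDr mulr_ge0 // mulr_ge0 ?(ltW M0) // addr_ge0 // -expr2 sqr_ge0 //.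
rewrite -real_normK ?num_real //.
apply: (@le_trans _ _ ((K%:R * B) ^+ 2)).
  by rewrite ler_sqr ?nnegrE ?mulr_ge0.
rewrite exprMn.
have HQ := drift_norm_decay T0; rewrite -/g -/a in HQ.
apply: (@le_trans _ _ (K%:R ^+ 2 * (4 * N%:R * (2 * (2 * M + N%:R) / T ^+ 2)))).
  rewrite ler_wpM2l ?sqr_ge0 // (le_trans HB) // ler_wpM2l // mulr_ge0 //.
by rewrite le_eqVlt; apply/orP; left; apply/eqP; field; rewrite gt_eqF.
Qed.

Lemma interior_mass (t : R) : 0 <= t -> 0 <= \sum_(i < N) rho i.+1 t <= N%:R.
Proof.
move=> t0; have H (i : 'I_N) : 0 <= rho i.+1 t <= 1.
  by apply: rho01 => //; have := ltn_ord i; lia.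
apply/andP; split; first by apply: sumr_ge0 => i _; case/andP: (H i).
rewrite -[N in N%:R]card_ord -sumr_const; apply: ler_sum => i _.
by case/andP: (H i).
Qed.

(** The total mass is conserved, and the channel carries at most [N] of it. *)
Lemma reservoir_sum_conserved (T : R) : 0 < T ->
  `|(rho K T + rho 0%N T) - (rho K 0 + rho 0%N 0)| <= N%:R / M.
Proof.
move=> T0.
have H : inner K M (fun=> 1) (rho^~ T) = inner K M (fun=> 1) (rho^~ 0).
  apply: (@derive0_constant R (fun s => inner K M (fun=> 1) (rho^~ s))) => //.
    move=> s s0; apply: (is_derive_eq (is_derive_inner_rho _ s0)).
    rewrite /energy big1 ?mulr0 ?oppr0 // => x _.
    by rewrite subrr mul0r.
  exact: inner_rho_cvg0.
rewrite !innerE in H.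
have /andP[a0 a1] := interior_mass (ltW T0).
have /andP[b0 b1] := interior_mass (lexx (0 : R)).
have E t : \sum_(i < N) 1 * rho i.+1 t = \sum_(i < N) rho i.+1 t.
  by apply: eq_bigr => i _; rewrite mul1r.
rewrite !E !mul1r in H.
rewrite ler_pdivlMr // -[X in _ * X](gtr0_norm M0) -normrM ler_norml.
move: H a0 a1 b0 b1; move: (\sum_(i < N) _) (\sum_(i < N) _) => u v.
by move=> *; lra.
Qed.

(** Pairing with the centred linear function isolates the difference of the
    reservoir densities, because that function has slope 1 on every bond: the
    energy telescopes. One error [N / M] comes from [relaxation_estimate]; the
    other two come from replacing [G] by [D] at times [T] and 0. *)
Lemma reservoir_difference_decay (T : R) : 0 < T ->
  `|(rho K T - rho 0%N T) - expR (- ((M * K%:R)^-1 * T)) * (rho K 0 - rho 0%N 0)|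
  <= 3 * (N%:R / M).
Proof.
move=> T0; set k := (M * K%:R)^-1; set c := N%:R / M.
have k0 : 0 <= k by rewrite invr_ge0 mulr_ge0 // (ltW M0).
have c0 : 0 <= c by rewrite divr_ge0 // (ltW M0).
(* 2 k normalises the pairing: its reservoir part becomes exactly D. *)
pose f x : R := x%:R - K%:R / 2.
pose D t := rho K t - rho 0%N t.
pose j t := 2 * k * \sum_(i < N) f i.+1 * rho i.+1 t.
pose G t := 2 * k * inner K M f (rho^~ t).
have KR0 : K%:R != 0 :> R by rewrite pnatr_eq0.
have MR0 : M != 0 by rewrite gt_eqF.
have GE t : G t = D t + j t.
  rewrite /G innerE mulrDr -/(j t); congr (_ + _); rewrite /f /D /k.
  by field; rewrite MR0 addrC natr1 KR0.
have jc t : 0 <= t -> `|j t| <= c.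
  move=> t0; rewrite /j normrM ger0_norm ?mulr_ge0 //.
  have -> : c = 2 * k * (N%:R * (K%:R / 2)).
    by rewrite /c /k; field; rewrite MR0 addrC natr1 KR0.
  rewrite ler_wpM2l ?mulr_ge0 // (le_trans (ler_norm_sum _ _ _)) //.
  rewrite -[N in N%:R]card_ord mulr_natl -sumr_const; apply: ler_sum => i _.
  have iN := ltn_ord i.
  have /andP[r0 r1] : 0 <= rho i.+1 t <= 1 by apply: rho01 => //; lia.
  rewrite normrM (ger0_norm r0) -[leRHS]mulr1 ler_pM // /f ler_norml.
  have h1 : (0 : R) <= i.+1%:R by [].
  have h2 : i.+1%:R <= K%:R :> R by rewrite ler_nat; lia.
  by apply/andP; split; lra.
have HG (s : R) : 0 < s -> is_derive s 1 G (- (k * (G s - j s))).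
  move=> s0; apply: (is_derive_eq (is_derive_scale (2 * k) (is_derive_inner_rho f s0))).
  rewrite GE addrK /energy.
  rewrite (eq_bigr (fun x : 'I_K => rho x.+1 s - rho x s)); last first.
    by move=> x _; rewrite /f -natr1; ring.
  rewrite -(big_mkord xpredT (fun x => rho x.+1 s - rho x s)) telescope_sumr //.
  by rewrite /D; field.
have G0 : G s @[s --> 0^'+] --> G 0.
  by apply: cvgM; [exact: cvg_cst | exact: inner_rho_cvg0].
have := relaxation_estimate k0 c0 T0 HG (fun s s0 => jc s (ltW s0)) G0.
rewrite !GE -/(D T) -/(D 0).
have := jc T (ltW T0); have := jc 0 (lexx 0).
have e0 := expR_ge0 (- (k * T)).
have e1 : expR (- (k * T)) <= 1.
  by rewrite -[leRHS]expR0 ler_expR oppr_le0 mulr_ge0 // (ltW T0).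
move: e0 e1; set e := expR _ => e0 e1 j0 jT HT.
have ej : `|e * j 0| <= c.
  by rewrite normrM (ger0_norm e0) -[leRHS]mul1r ler_pM.
move: ej jT HT; rewrite mulrDr !ler_norml => /andP[? ?] /andP[? ?] /andP[? ?].
apply/andP; split; lra.
Qed.

End DensityProfile.

(** * Mean densities of the channel-reservoir process *)

Section MarkovExpectation.
Variables (R : realType) (d : measure_display) (T : measurableType d).
Variables (P : probability T R) (S : finType) (X : R -> T -> S).
Variable p : R -> S -> S -> R.
Hypothesis X_measurable : forall t a, 0 <= t -> measurable (X t @^-1` [set a]).
Hypothesis X_markov : forall s h a b A, 0 <= s -> 0 <= h ->
  natural_filtration X s A ->
  P (A `&` X s @^-1` [set a] `&` X (s + h) @^-1` [set b]) =
  (P (A `&` X s @^-1` [set a]) * (p h a b)%:E)%E.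

Definition initial_law (a : S) : R := fine (P (X 0 @^-1` [set a])).

Lemma initial_law_ge0 a : 0 <= initial_law a.
Proof. exact: fine_ge0. Qed.

(** The Markov property at time 0, conditioned on the trivial event. *)
Lemma joint_law t a b : 0 <= t ->
  P (X 0 @^-1` [set a] `&` X t @^-1` [set b]) = (initial_law a * p t a b)%:E.
Proof.
move=> t0.
(* The whole space is the complement of the empty set in any sigma-algebra. *)
have FT : natural_filtration X 0 setT.
  by move=> B [[B0 BC _] _]; rewrite -(setD0 setT); exact: BC.
have := X_markov a b (lexx 0) t0 FT.
rewrite !setTI add0r => ->; rewrite EFinM fineK // fin_num_measure //.
exact: X_measurable.
Qed.

(** Decomposing over the pair of states at times 0 and [t] avoids computing
    the law of [X t] separately. *)
Lemma markov_expectation (f : S -> R) (t : R) :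
  (forall a, 0 <= f a) -> 0 <= t ->
  'E_P[fun o => f (X t o)]%E =
  (\sum_a initial_law a * semigroup_act p t f a)%:E.
Proof.
move=> f0 t0; rewrite unlock.
pose E (ab : S * S) := X 0 @^-1` [set ab.1] `&` X t @^-1` [set ab.2].
have mE ab : measurable (E ab) by apply: measurableI; exact: X_measurable.
have -> : (\int[P]_o (f (X t o))%:E =
    \int[P]_o \sum_(ab : S * S) ((f ab.2)%:E * (\1_(E ab) o)%:E))%E.
  apply: eq_integral => o _.
  rewrite (bigD1 (X 0 o, X t o)) //= big1 ?adde0; last first.
    move=> [a b] /= ab; rewrite indicE memNset ?mule0 // => -[/= ea eb].
    by move: ab; rewrite -ea -eb eqxx.
  by rewrite indicE mem_set // mule1.
rewrite ge0_integral_sum //; last 2 first.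
- move=> ab; apply: emeasurable_funM; first exact: measurable_cst.
  by apply/measurable_EFinP; exact: measurable_indic.
- by move=> ab o _; rewrite mule_ge0 ?lee_fin.
have -> : (\sum_(ab : S * S) \int[P]_o ((f ab.2)%:E * (\1_(E ab) o)%:E) =
    \sum_(ab : S * S) (f ab.2 * (initial_law ab.1 * p t ab.1 ab.2))%:E)%E.
  apply: eq_bigr => -[a b] _; rewrite ge0_integralZl_EFin //.
  - by rewrite integral_indic // setIT /= [RHS]EFinM -joint_law.
  - by apply/measurable_EFinP; exact: measurable_indic.
rewrite sumEFin; congr EFin.
rewrite -(pair_bigA _ (fun a b => f b * (initial_law a * p t a b))) /=.
apply: eq_bigr => a _; rewrite /semigroup_act mulr_sumr.
by apply: eq_bigr => b _; rewrite mulrC mulrA.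
Qed.

End MarkovExpectation.

Lemma density01 (R : realType) (n M : nat) (w : state n M) (x : nat) :
  0 <= density R w x <= 1.
Proof.
have H (k m : nat) : (k <= m)%N -> 0 <= (k%:R / m%:R : R) <= 1.
  move=> km; apply/andP; split; first by rewrite divr_ge0.
  have [->|m0] := posnP m; first by rewrite invr0 mulr0.
  by rewrite ler_pdivrMr ?ltr0n // mul1r ler_nat.
rewrite /density; case: ifP => _; first exact/H/leq_ord.
case: ifP => _; last exact/H/leq_ord.
by case: (Defs.eta w _); rewrite ?lexx ler01.
Qed.

(** The last clause compares the initial mean with a prospective limit [v]:
    values in the unit interval differ from [v] by at most [delta], except on
    the event of a larger deviation, where they differ by at most 1. *)
Lemma mean_density_system (R : realType) (n M : nat) (d : measure_display)
    (T : measurableType d) (P : probability T R) (X : R -> T -> state n M) :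
  (0 < M)%N -> markov_chain P (@generator R n M) X ->
  exists rho : nat -> R -> R,
    [/\ forall x t, 0 <= t -> mean_density P X x t = (rho x t)%:E,
        forall (x : nat) (t : R), (x <= n.+2)%N -> 0 < t ->
          is_derive t 1 (rho x) (drift n.+2 M%:R (rho^~ t) x),
        forall x, rho x s @[s --> 0^'+] --> rho x 0,
        forall (x : nat) (t : R), 0 <= t -> 0 <= rho x t <= 1 &
        forall (x : nat) (v delta : R), 0 <= v <= 1 -> 0 < delta ->
          (`|rho x 0 - v|%:E <=
           delta%:E + P [set o | (delta <= `|density R (X 0 o) x - v|)%R])%E].
Proof.
move=> M0 [Xm [p hp Xmk]].
pose q := initial_law P X.
have EX := markov_expectation Xm Xmk.
pose rho (x : nat) (t : R) := \sum_a q a * semigroup_act p t (fun w => density R w x) a.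
have q1 : \sum_a q a = 1.
  have := EX (fun=> 1) 0 (fun=> ler01) (lexx 0).
  rewrite unlock integral_cst // -[X in (_ * X)%E]/(P setT) probability_setT mule1 => -[->].
  apply: eq_bigr => a _; rewrite /semigroup_act.
  under eq_bigr do rewrite mulr1.
  by rewrite (ts_sum1 hp) // mulr1.
have act0 f a : semigroup_act p 0 f a = f a.
  rewrite /semigroup_act (bigD1 a) //= (ts_0 hp) eqxx mul1r big1 ?addr0 // => b.
  by rewrite (ts_0 hp) eq_sym => /negPf ->; rewrite mul0r.
have rhoE x t : 0 <= t -> mean_density P X x t = (rho x t)%:E.
  by move=> t0; apply: EX => // w; have /andP[] := density01 R w x.
exists rho; split => //.
- move=> x t xn t0.
  have -> : drift n.+2 M%:R (rho^~ t) x =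
      \sum_a q a * semigroup_act p t (@generator R n M (fun w => density R w x)) a.
    have -> : @generator R n M (fun w => density R w x) =
        (fun w => drift n.+2 M%:R (density R w) x).
      by apply/funext => w; rewrite generator_density.
    rewrite /drift /reflecting_laplacian /rho.
    rewrite -!sumrB !mulr_sumr; apply: eq_bigr => a _.
    by rewrite !semigroup_actZ !semigroup_actB; ring.
  apply: is_derive_fin_sum => a; apply: is_derive_scale.
  exact: (is_derive_semigroup_act hp).
- move=> x; apply: cvg_fin_sum => a; apply: cvgM; first exact: cvg_cst.
  by rewrite act0; exact: (semigroup_act_cvg0 hp).
- move=> x t t0.
  have A a : 0 <= semigroup_act p t (fun w => density R w x) a <= 1.
    apply/andP; split.
      apply: sumr_ge0 => b _; rewrite mulr_ge0 ?(ts_ge0 hp) //.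
      by have /andP[] := density01 R b x.
    rewrite -(ts_sum1 hp a t0); apply: ler_sum => b _.
    rewrite -[leRHS]mulr1 ler_wpM2l ?(ts_ge0 hp) //.
    by have /andP[] := density01 R b x.
  apply/andP; split.
    apply: sumr_ge0 => a _; rewrite mulr_ge0 ?initial_law_ge0 //.
    by have /andP[] := A a.
  rewrite -q1; apply: ler_sum => a _.
  rewrite -[leRHS]mulr1 ler_wpM2l ?initial_law_ge0 //.
  by have /andP[] := A a.
- move=> x v delta v01 delta0.
  (* The deviation event is a union of finitely many fibres of X 0, so its
     probability is an average over the initial law. *)
  pose far (w : state n M) : bool := delta <= `|density R w x - v|.
  have PE : P [set o | far (X 0 o)] = (\sum_a q a * (far a)%:R)%:E.
    have -> : [set o | far (X 0 o)] = \bigcup_(a in [set a | far a]) (X 0 @^-1` [set a]).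
      apply/seteqP; split => o /=; first by move=> fo; exists (X 0 o).
      by move=> [a /= fa ->].
    have mB : measurable (\bigcup_(a in [set a | far a]) (X 0 @^-1` [set a])).
      by apply: fin_bigcup_measurable => // a _; exact: Xm.
    rewrite -expectation_indic //.
    have -> : \1_(\bigcup_(a in [set a | far a]) (X 0 @^-1` [set a])) =
        (fun o => (far (X 0 o))%:R) :> (T -> R).
      apply/funext => o; rewrite indicE; congr (_ %:R); congr nat_of_bool.
      apply/idP/idP; first by rewrite inE => -[a /= fa ->].
      by move=> fo; rewrite inE; exists (X 0 o).
    rewrite (EX (fun w => (far w)%:R)) //.
    by congr EFin; apply: eq_bigr => a _; rewrite act0.
  rewrite -[X in P X]/[set o | far (X 0 o)] PE -EFinD lee_fin.
  have -> : rho x 0 - v = \sum_a q a * (density R a x - v).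
    under [RHS]eq_bigr do rewrite mulrBr.
    rewrite sumrB -mulr_suml q1 mul1r; congr (_ - _).
    by apply: eq_bigr => a _; rewrite act0.
  rewrite (le_trans (ler_norm_sum _ _ _)) //.
  have dE : delta = \sum_a q a * delta by rewrite -mulr_suml q1 mul1r.
  rewrite [X in _ <= X + _]dE -big_split /=; apply: ler_sum => a _.
  have q0 : 0 <= q a by exact: initial_law_ge0.
  rewrite normrM ger0_norm // -mulrDr ler_wpM2l //.
  rewrite /far; case: (leP delta `|density R a x - v|) => [_|/ltW h]; last by rewrite addr0.
  have /andP[a0 a1] := density01 R a x; case/andP: v01 => v0 v1.
  by rewrite mulr1n ler_norml; apply/andP; split; lra.
Qed.

(** * Asymptotics of the parameters *)

Lemma cvg_of_vanishing_error (R : realType) (u b : R ^nat) :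
  (forall n, `|u n| <= b n) -> b n @[n --> \oo] --> (0 : R) ->
  u n @[n --> \oo] --> (0 : R).
Proof.
move=> ub b0; apply: norm_cvg0.
have C0 : cst 0 n @[n --> \oo] --> (0 : R) by exact: cvg_cst.
by apply: squeeze_cvgr C0 b0; apply: nearW => n; rewrite normr_ge0 ub.
Qed.

Lemma cvg_of_vanishing_square (R : realType) (u b : R ^nat) :
  (forall n, u n ^+ 2 <= b n) -> b n @[n --> \oo] --> (0 : R) ->
  u n @[n --> \oo] --> (0 : R).
Proof.
move=> ub b0; apply/cvgrPdist_le => e e0; near=> n.
rewrite sub0r normrN -ler_sqr ?nnegrE ?(ltW e0) // real_normK ?num_real //.
apply: (le_trans (ub n)); apply: ltW.
by near: n; apply: (cvgr_lt 0 b0); rewrite exprn_gt0.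
Unshelve. all: by end_near. Qed.

Section Scaling.
Variables (R : realType) (alpha : R).
Hypothesis alpha_gt0 : 0 < alpha.

Let sites (n : nat) : R := n.+1%:R.
(** The number whose integer part is the reservoir size. *)
Let capacity (n : nat) : R := n.+1%:R `^ (1 + alpha).
Let reservoir (n : nat) : R := (reservoir_size alpha n.+1)%:R.

Lemma cvg_invr_powR : (n.+1%:R `^ alpha)^-1 @[n --> \oo] --> (0 : R).
Proof.
have -> : (fun n : nat => (n.+1%:R `^ alpha)^-1) =
    (fun n => harmonic n `^ alpha) :> (nat -> R).
  apply/funext => n.
  by rewrite /harmonic -powRN -mulN1r powRrM powR_inv1.
have /cvg_at_rightP := powR_cvg0 alpha_gt0; apply.
by split; [move=> n; exact: harmonic_gt0 | exact: cvg_harmonic].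
Qed.

Lemma capacityE n : capacity n = sites n * n.+1%:R `^ alpha.
Proof. by rewrite /capacity powRD ?pnatr_eq0 ?implybT // powRr1. Qed.

Lemma capacity_gt0 n : 0 < capacity n.
Proof. by rewrite powR_gt0. Qed.

Lemma sites_le_capacity n : sites n <= capacity n.
Proof. by apply: le1r_powR; [rewrite ler1n | rewrite lerDl ltW]. Qed.

Lemma reservoir_size_gt0 n : (0 < reservoir_size alpha n.+1)%N.
Proof.
by rewrite truncn_gt0 (le_trans _ (sites_le_capacity n)) // ler1n.
Qed.

Lemma reservoir_gt0 n : 0 < reservoir n.
Proof. by rewrite ltr0n reservoir_size_gt0. Qed.

Lemma reservoir_bounds n : capacity n - 1 <= reservoir n <= capacity n.
Proof.
have /andP[h1 h2] := truncn_itv (ltW (capacity_gt0 n)).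
by rewrite h1 andbT lerBlDr natr1 ltW.
Qed.

Lemma cvg_sites_capacity : sites n / capacity n @[n --> \oo] --> (0 : R).
Proof.
have -> : (fun n => sites n / capacity n) = (fun n : nat => (n.+1%:R `^ alpha)^-1).
  apply/funext => n; rewrite capacityE invfM mulrA divff ?mul1r //.
  by rewrite pnatr_eq0.
exact: cvg_invr_powR.
Qed.

Lemma cvg_reservoir_capacity : reservoir n / capacity n @[n --> \oo] --> (1 : R).
Proof.
have C1 : cst 1 n @[n --> \oo] --> (1 : R) by exact: cvg_cst.
have C2 : 1 - sites n / capacity n @[n --> \oo] --> (1 : R).
  rewrite -[X in _ --> X]subr0; apply: cvgB => //; exact: cvg_sites_capacity.
apply: squeeze_cvgr C2 C1; apply: nearW => n.
have /andP[h1 h2] := reservoir_bounds n; have v0 := capacity_gt0 n.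
rewrite ler_pdivrMr // mul1r h2 andbT ler_pdivlMr // mulrBl mul1r divfK ?gt_eqF //.
by rewrite (le_trans _ h1) // lerD2l lerN2 ler1n.
Qed.

Lemma cvg_edges_sites : n.+2%:R / sites n @[n --> \oo] --> (1 : R).
Proof.
have -> : (fun n : nat => n.+2%:R / sites n) = (fun n => 1 + harmonic n).
  by apply/funext => n; rewrite /harmonic -[n.+2%:R]natr1 mulrDl divff ?mul1r // pnatr_eq0.
rewrite -[X in _ --> X]addr0; apply: cvgD; [exact: cvg_cst|exact: cvg_harmonic].
Qed.

Lemma cvg_sites_reservoir : sites n / reservoir n @[n --> \oo] --> (0 : R).
Proof.
have H : (sites n / capacity n) * (reservoir n / capacity n)^-1 @[n --> \oo] --> (0 * 1^-1 : R).
  by apply: cvgM; [exact: cvg_sites_capacity | exact: cvgV cvg_reservoir_capacity].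
rewrite mul0r in H; apply: (cvg_near_eq _ H); apply: nearW => n /=.
by field; rewrite !gt_eqF // ?reservoir_gt0 ?capacity_gt0.
Qed.

Lemma observation_timeE n : n.+1%:R `^ (2 + alpha) = capacity n * sites n.
Proof.
by rewrite /capacity (_ : 2 + alpha = (1 + alpha) + 1) ?powRD
  ?pnatr_eq0 ?implybT // ?powRr1 //; ring.
Qed.

(** The relaxation rate of the reservoir difference, multiplied by the
    observation time. *)
Lemma cvg_relaxation_time (t : R) :
  (reservoir n * n.+2%:R)^-1 * (n.+1%:R `^ (2 + alpha) * t) @[n --> \oo] --> t.
Proof.
have H : (reservoir n / capacity n)^-1 * (n.+2%:R / sites n)^-1 * t @[n --> \oo]
    --> (1^-1 * 1^-1 * t : R).
  apply: cvgM; last exact: cvg_cst.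
  by apply: cvgM; [exact: cvgV cvg_reservoir_capacity | exact: cvgV cvg_edges_sites].
rewrite invr1 !mul1r in H; apply: (cvg_near_eq _ H); apply: nearW => n /=.
rewrite observation_timeE.
have h : n.+2%:R != 0 :> R by rewrite pnatr_eq0.
have h' : sites n != 0 by rewrite pnatr_eq0.
have hs := gt_eqF (reservoir_gt0 n); have hv := gt_eqF (capacity_gt0 n).
move: h h' hs hv; move: (n.+2%:R) (sites n) (reservoir n) (capacity n) => a b c e h h' hs hv.
by field; rewrite h h' hs hv.
Qed.

(** Writing [q] for [sites n / capacity n], which is [n.+1%:R `^ (- alpha)],
    the quotient is asymptotic to a constant multiple of [q]. *)
Lemma cvg_profile_error (t : R) : 0 < t ->
  8 * n.+2%:R ^+ 2 * sites n * (2 * reservoir n + sites n) /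
    (n.+1%:R `^ (2 + alpha) * t) ^+ 2 @[n --> \oo] --> 0.
Proof.
move=> t0.
have H : 8 / t ^+ 2 * ((n.+2%:R / sites n) * (n.+2%:R / sites n) *
    (2 * (reservoir n / capacity n) + sites n / capacity n) *
    (sites n / capacity n)) @[n --> \oo]
    --> (8 / t ^+ 2 * (1 * 1 * (2 * 1 + 0) * 0) : R).
  apply: cvgM; first exact: cvg_cst.
  apply: cvgM; last exact: cvg_sites_capacity.
  apply: cvgM; first by apply: cvgM; exact: cvg_edges_sites.
  apply: cvgD; last exact: cvg_sites_capacity.
  by apply: cvgM; [exact: cvg_cst | exact: cvg_reservoir_capacity].
rewrite !mulr0 in H; apply: (cvg_near_eq _ H); apply: nearW => n /=.
rewrite observation_timeE.
have h' : sites n != 0 by rewrite pnatr_eq0.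
have hv := gt_eqF (capacity_gt0 n); have ht := gt_eqF t0.
move: h' hv; move: (n.+2%:R) (sites n) (reservoir n) (capacity n) => a b c e h' hv.
by field; rewrite h' hv ht.
Qed.

Lemma cvg_macroscopic_site (r : R) : 0 <= r ->
  (Num.truncn (n.+1%:R * r))%:R / n.+2%:R @[n --> \oo] --> r.
Proof.
move=> r0.
have H : (Num.truncn (n.+1%:R * r))%:R / sites n @[n --> \oo] --> r.
  have C1 : cst r n @[n --> \oo] --> r by exact: cvg_cst.
  have C2 : r - harmonic n @[n --> \oo] --> r.
    rewrite -[X in _ --> X]subr0; apply: cvgB => //; exact: cvg_harmonic.
  apply: squeeze_cvgr C2 C1; apply: nearW => n.
  have N0 : 0 < n.+1%:R :> R by rewrite ltr0n.
  have /andP[h1 h2] := truncn_itv (mulr_ge0 (ltW N0) r0).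
  rewrite ler_pdivrMr // [r * _]mulrC h1 andbT ler_pdivlMr //.
  rewrite mulrBl /harmonic mulVf ?gt_eqF // lerBlDr natr1 mulrC.
  exact: ltW.
have H' : (Num.truncn (n.+1%:R * r))%:R / sites n *
    (n.+2%:R / sites n)^-1 @[n --> \oo] --> r * 1^-1.
  by apply: cvgM => //; exact: cvgV cvg_edges_sites.
rewrite invr1 mulr1 in H'; apply: (cvg_near_eq _ H'); apply: nearW => n /=.
have h : n.+2%:R != 0 :> R by rewrite pnatr_eq0.
have h' : sites n != 0 by rewrite pnatr_eq0.
move: h h'; move: (n.+2%:R) (sites n) (Num.truncn _)%:R => a b c h h'.
by field; rewrite h h'.
Qed.

End Scaling.

(** Here [m n] stands for the mean of a variable [Y n] in the unit interval; the
    premise is the deviation bound of [mean_density_system]. *)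
Lemma cvg_mean_of_cvg_in_probability (R : realType) (d : nat -> measure_display)
    (T : forall n, measurableType (d n)) (P : forall n, probability (T n) R)
    (Y : forall n, T n -> R) (m : R ^nat) (l : R) :
  (forall n (delta : R), 0 < delta ->
    (`|m n - l|%:E <= delta%:E + P n [set o | (delta <= `|Y n o - l|)%R])%E) ->
  cvg_in_probability P Y l -> m n @[n --> \oo] --> l.
Proof.
move=> H HP; apply/cvgrPdist_le => e e0.
have e2 : 0 < e / 2 by rewrite divr_gt0.
have /fine_cvgP[fin HF] := HP _ e2.
near=> n.
rewrite distrC -lee_fin (le_trans (H n _ e2)) //.
rewrite -[leRHS]/((e)%:E) [in leRHS](splitr e) EFinD leeD2l //.
rewrite -[leLHS]fineK; last by near: n.
by rewrite lee_fin ltW //; near: n; apply: (cvgr_lt 0 HF).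
Unshelve. all: by end_near. Qed.

Unset Implicit Arguments.
Set Strict Implicit.

(* The index n stands for N = n.+1. *)
Theorem theorem4p1 (R : realType) (alpha : R) (halpha : 0 < alpha)
    (u0 : R -> R)
    (hu0 : forall x, 0 < x <= 1 -> 0 <= u0 x <= 1)
    (hu0c : forall x, 0 < x < 1 -> {for x, continuous u0})
    (v0m v0p : R) (hv0m : 0 <= v0m <= 1) (hv0p : 0 <= v0p <= 1)
    (d : nat -> measure_display) (T : forall n, measurableType (d n))
    (P : forall n, probability (T n) R)
    (X : forall n, R -> T n -> state n (reservoir_size alpha n.+1))
    (hX : forall n, markov_chain (P n) (@generator R _ _) (X n))
    (hm : cvg_in_probability P
       (fun n o => (nminus (X n 0 o))%:R / (reservoir_size alpha n.+1)%:R) v0m)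
    (hp : cvg_in_probability P
       (fun n o => (nplus (X n 0 o))%:R / (reservoir_size alpha n.+1)%:R) v0p)
    (hinit : forall n x, (1 <= x <= n.+1)%N ->
       mean_density (P n) (X n) x 0 = (u0 (n.+1%:R^-1 * x%:R))%:E) :
  exists vm vp : R -> R,
    [/\ vm t @[t --> 0^'+] --> v0m,
        vp t @[t --> 0^'+] --> v0p,
        (forall t : R, 0 < t -> is_derive t 1 vm (2^-1 * (vp t - vm t))) &
        (forall t : R, 0 < t -> is_derive t 1 vp (- (2^-1 * (vp t - vm t))))]
    /\ forall r t : R, 0 <= r <= 1 -> 0 < t ->
      [/\ mean_density (P n) (X n) (Num.truncn (n.+1%:R * r))
            (n.+1%:R `^ (2 + alpha) * t) @[n --> \oo]
            --> ((vp t - vm t) * r + vm t)%:E,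
          mean_density (P n) (X n) 0 (n.+1%:R `^ (2 + alpha) * t) @[n --> \oo]
            --> (vm t)%:E &
          mean_density (P n) (X n) n.+2 (n.+1%:R `^ (2 + alpha) * t)
            @[n --> \oo] --> (vp t)%:E].
Proof.
have [rho rhoP] := choice (fun n =>
  mean_density_system (reservoir_size_gt0 halpha n) (hX n)).
have rho0m : rho n 0%N 0 @[n --> \oo] --> v0m.
  apply: cvg_mean_of_cvg_in_probability hm => n delta delta0.
  by have [_ _ _ _ /(_ 0%N v0m delta hv0m delta0)] := rhoP n.
have rho0p : rho n n.+2 0 @[n --> \oo] --> v0p.
  apply: cvg_mean_of_cvg_in_probability hp => n delta delta0.
  have [_ _ _ _ /(_ n.+2 v0p delta hv0p delta0)] := rhoP n.
  by under eq_set do rewrite densityr.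
(* The sum of the two reservoir densities is constant in the limit, and their
   difference is multiplied by expR (- t). *)
pose vm t := 2^-1 * ((v0p + v0m) - expR (- t) * (v0p - v0m)).
pose vp t := 2^-1 * ((v0p + v0m) + expR (- t) * (v0p - v0m)).
have expN (t : R) : is_derive t 1 (fun s => expR (- s)) (- expR (- t)).
  have HN : is_derive t 1 (fun s : R => - s) (- 1) by exact: is_deriveN.
  have := @is_derive1_comp R expR (fun s => - s) t _ _ (is_derive_expR _) HN.
  by rewrite mulrN1.
have dm (t : R) : is_derive t 1 vm (2^-1 * (vp t - vm t)).
  have := is_derive_scale 2^-1 (is_derive_sub (is_derive_cst (v0p + v0m) t 1)
    (is_derive_mul (expN t) (is_derive_cst (v0p - v0m) t 1))).
  by move=> H; apply: (is_derive_eq H); rewrite /vp /vm /cst; field.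
have dp (t : R) : is_derive t 1 vp (- (2^-1 * (vp t - vm t))).
  have := is_derive_scale 2^-1 (is_derive_add (is_derive_cst (v0p + v0m) t 1)
    (is_derive_mul (expN t) (is_derive_cst (v0p - v0m) t 1))).
  by move=> H; apply: (is_derive_eq H); rewrite /vp /vm /cst; field.
have at0 (f : R -> R) (df l : R) : is_derive (0 : R) 1 f df -> f 0 = l -> f t @[t --> 0^'+] --> l.
  move=> [Hf _] <-; apply: cvg_at_right_filter.
  exact/differentiable_continuous/derivable1_diffP.
exists vm, vp; split.
  split => //.
  - by apply: (at0 _ _ _ (dm 0)); rewrite /vm oppr0 expR0; field.
  - by apply: (at0 _ _ _ (dp 0)); rewrite /vp oppr0 expR0; field.
move=> r t /andP[r0 r1] t0.
pose tau n := n.+1%:R `^ (2 + alpha) * t.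
have tau0 n : 0 < tau n by rewrite mulr_gt0 // powR_gt0.
pose M n : R := (reservoir_size alpha n.+1)%:R.
have M0 n : 0 < M n by rewrite ltr0n reservoir_size_gt0.
have rD n (x : nat) (s : R) : (x <= n.+2)%N -> 0 < s ->
  is_derive s 1 (rho n x) (drift n.+2 (M n) ((rho n)^~ s) x).
  by have [_ H _ _ _] := rhoP n; exact: H.
have rC n (x : nat) : (x <= n.+2)%N -> rho n x s @[s --> 0^'+] --> rho n x 0.
  by move=> _; have [_ _ H _ _] := rhoP n; exact: H.
have r01 n (x : nat) (s : R) : (x <= n.+2)%N -> 0 <= s -> 0 <= rho n x s <= 1.
  by move=> _; have [_ _ _ H _] := rhoP n; exact: H.
have csum : (rho n n.+2 (tau n) + rho n 0%N (tau n)) @[n --> \oo] --> v0p + v0m.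
  have H : (rho n n.+2 (tau n) + rho n 0%N (tau n)) - (rho n n.+2 0 + rho n 0%N 0) @[n --> \oo] --> (0 : R).
    apply: cvg_of_vanishing_error (cvg_sites_reservoir halpha) => n.
    exact: (reservoir_sum_conserved (M0 n) (rD n) (rC n) (r01 n)).
  have H' : (rho n n.+2 (tau n) + rho n 0%N (tau n)) - (rho n n.+2 0 + rho n 0%N 0) +
      (rho n n.+2 0 + rho n 0%N 0) @[n --> \oo] --> 0 + (v0p + v0m).
    by apply: cvgD => //; exact: cvgD.
  rewrite add0r in H'.
  by apply: (cvg_near_eq _ H'); apply: nearW => n /=; rewrite subrK.
have cdiff : (rho n n.+2 (tau n) - rho n 0%N (tau n)) @[n --> \oo] --> expR (- t) * (v0p - v0m).
  have H : (rho n n.+2 (tau n) - rho n 0%N (tau n)) -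
      expR (- ((M n * n.+2%:R)^-1 * tau n)) * (rho n n.+2 0 - rho n 0%N 0) @[n --> \oo] --> (0 : R).
    have c3 : 3 * (n.+1%:R / M n) @[n --> \oo] --> (0 : R).
      rewrite -[X in _ --> X](mulr0 3); apply: cvgM; first exact: cvg_cst.
      exact: cvg_sites_reservoir.
    apply: cvg_of_vanishing_error c3 => n.
    exact: (reservoir_difference_decay (M0 n) (rD n) (rC n) (r01 n)).
  have He : expR (- ((M n * n.+2%:R)^-1 * tau n)) @[n --> \oo] --> expR (- t).
    apply: continuous_cvg; first exact: continuous_expR.
    by apply: cvgN; exact: cvg_relaxation_time.
  have H' : (rho n n.+2 (tau n) - rho n 0%N (tau n)) -
      expR (- ((M n * n.+2%:R)^-1 * tau n)) * (rho n n.+2 0 - rho n 0%N 0) +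
      expR (- ((M n * n.+2%:R)^-1 * tau n)) * (rho n n.+2 0 - rho n 0%N 0)
      @[n --> \oo] --> 0 + expR (- t) * (v0p - v0m).
    by apply: cvgD => //; apply: cvgM => //; exact: cvgB.
  rewrite add0r in H'.
  by apply: (cvg_near_eq _ H'); apply: nearW => n /=; rewrite subrK.
have cm : rho n 0%N (tau n) @[n --> \oo] --> vm t.
  have H : 2^-1 * ((rho n n.+2 (tau n) + rho n 0%N (tau n)) -
      (rho n n.+2 (tau n) - rho n 0%N (tau n))) @[n --> \oo] --> vm t.
    by apply: cvgM; [exact: cvg_cst | exact: cvgB].
  by apply: (cvg_near_eq _ H); apply: nearW => n /=; field.
have cp : rho n n.+2 (tau n) @[n --> \oo] --> vp t.
  have H : 2^-1 * ((rho n n.+2 (tau n) + rho n 0%N (tau n)) +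
      (rho n n.+2 (tau n) - rho n 0%N (tau n))) @[n --> \oo] --> vp t.
    by apply: cvgM; [exact: cvg_cst | exact: cvgD].
  by apply: (cvg_near_eq _ H); apply: nearW => n /=; field.
pose site n := Num.truncn (n.+1%:R * r).
have ci : rho n (site n) (tau n) @[n --> \oo] --> (vp t - vm t) * r + vm t.
  have siteK n : (site n <= n.+2)%N.
    rewrite -(ler_nat R); have nr : 0 <= n.+1%:R * r by rewrite mulr_ge0.
    have /andP[h _] := truncn_itv nr; apply: (le_trans h).
    by apply: (le_trans (ler_piMr (ler0n _ _) r1)); rewrite ler_nat.
  have H : rho n (site n) (tau n) - (rho n 0%N (tau n) +
      (site n)%:R / n.+2%:R * (rho n n.+2 (tau n) - rho n 0%N (tau n))) @[n --> \oo] --> (0 : R).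
    apply: cvg_of_vanishing_square (cvg_profile_error halpha t0) => n.
    exact: (profile_near_linear (M0 n) (rD n) (r01 n)).
  pose lin n := rho n 0%N (tau n) +
    (site n)%:R / n.+2%:R * (rho n n.+2 (tau n) - rho n 0%N (tau n)).
  have H' : rho n (site n) (tau n) - lin n + lin n @[n --> \oo] -->
      0 + (vm t + r * (vp t - vm t)).
    apply: cvgD => //; apply: cvgD => //; apply: cvgM; last exact: cvgB.
    exact: cvg_macroscopic_site.
  rewrite add0r addrC mulrC in H'.
  by apply: (cvg_near_eq _ H'); apply: nearW => n /=; rewrite subrK.
have lift (x : nat -> nat) (l : R) : rho n (x n) (tau n) @[n --> \oo] --> l ->
    mean_density (P n) (X n) (x n) (tau n) @[n --> \oo] --> l%:E.
  move=> xl.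
  have -> : (fun n => mean_density (P n) (X n) (x n) (tau n)) = (fun n => (rho n (x n) (tau n))%:E).
    by apply/funext => n; have [H _ _ _ _] := rhoP n; rewrite H // ltW.
  by apply: cvg_EFin => //; apply: nearW.
by split; [exact: (lift site) | exact: (lift (fun=> 0%N)) | exact: (lift (fun n => n.+2))].
Qed.
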